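(* Let $K$ be a field and let $G$ be a Cameron--Walker graph. Then $a(K[V(G)]/I(G)) = 0$, that is, $\deg h(K[V(G)]/I(G),\lambda) = \dim K[V(G)]/I(G)$.
   Context: $K$ is a field. For a finite simple graph $G$ on the vertex set $V(G)=\{x_1,\dots,x_n\}$, let $K[V(G)]$ be the polynomial ring over $K$ in the vertices of $G$ as variables, each of degree $1$, and let $I(G)=(x_ix_j : \{x_i,x_j\}\in E(G))\subset K[V(G)]$ be the edge ideal. For a homogeneous ideal $I$ of a standard graded polynomial ring $S$ over $K$ with $d=\dim S/I$ (Krull dimension), the Hilbert series is written $H(S/I,\lambda)=\frac{h_0+h_1\lambda+\cdots+h_s\lambda^s}{(1-\lambda)^d}$ with $h_i\in\mathbb{Z}$ and $h_s\neq 0$; the numerator is the $h$-polynomial $h(S/I,\lambda)$, so $\deg h(S/I,\lambda)=s$. The $a$-invariant is $a(S/I)=\deg h(S/I,\lambda)-\dim S/I$. Cameron--Walker graphs: A star graph is a graph obtained by joining some (at least one) paths of length $1$ at one common vertex. A star triangle is a graph obtained by joining some (at least one) triangles at one common vertex. A Cameron--Walker graph is a finite connected simple graph, neither a star graph nor a star triangle, consisting of a connected bipartite graph with vertex partition $\{v_1,\dots,v_m\}\cup\{w_1,\dots,w_n\}$ ($m,n\ge 1$) such that at least one leaf edge is attached to each $v_i$ and possibly some pendant triangles are attached to each $w_j$ (a leaf edge is an edge meeting a vertex of degree $1$; a pendant triangle is a triangle two of whose vertices have degree $2$ and whose remaining vertex has degree more than $2$). (By a theorem of Cameron and Walker, these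 are exactly the finite connected simple graphs with at least one edge whose induced matching number equals the matching number and which are neither star graphs nor star triangles.) *)

(* Defs.v *)
From HB Require Import structures.
From mathcomp Require Import all_boot all_order all_algebra.
From mathcomp Require Import generic_quotient ring_quotient.
From mathcomp Require Import boolp.
From mathcomp Require Import mpoly.

Set Implicit Arguments.
Unset Strict Implicit.
Unset Printing Implicit Defensive.

Import GRing.Theory.

Local Open Scope ring_scope.
Local Open Scope quotient_scope.

Record sgraph (V : finType) := SGraph {
  adj :> rel V;
  adj_sym : ssrbool.symmetric adj;
  adj_irr : irreflexive adj
}.

Section Graphs.
Variables (V : finType) (G : sgraph V).

Definition nbh (x : V) : {set V} := [set y | G x y].
Definition deg (x : V) : nat := #|nbh x|.

(* The subgraph of [G] induced on [A] is nonempty and connected. *)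
Definition connected_on (A : {set V}) : Prop :=
  A != set0 /\
  {in A &, forall x y,
     connect (fun a b => [&& a \in A, b \in A & G a b]) x y}.

Definition star : Prop :=
  (1 < #|V|)%N /\
  exists c : V, forall x y, G x y = (x != y) && ((x == c) || (y == c)).

(* [nbh x = [set c; y]] with [y != x] holds for both non-central vertices of a
   triangle {c, x, y}, so the triangles through [c] only meet in [c]. *)
Definition star_triangle : Prop :=
  (1 < #|V|)%N /\
  exists c : V, forall x, x != c -> exists2 y, y != c & nbh x = [set c; y].

Definition leaf_at (v x : V) : bool := G v x && (deg x == 1%N).

Definition pendant_triangle_at (w x y : V) : bool :=
  [&& G w x, G w y, G x y, deg x == 2%N, deg y == 2%N & (2 < deg w)%N].

(* [A] = {v_1, ..., v_m} and [B] = {w_1, ..., w_n}.  As a leaf has degree 1 and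
   the two attached vertices of a pendant triangle have degree 2, the last
   clause leaves no room for edges other than those of the bipartite graph on
   [A :|: B], the leaf edges at [A] and the edges of the pendant triangles at
   [B]. *)
Definition cameron_walker_parts (A B : {set V}) : Prop :=
  [/\ [/\ [disjoint A & B], A != set0 & B != set0],
      [/\ connected_on (A :|: B),
          {in A &, forall x y, ~~ G x y}
        & {in B &, forall x y, ~~ G x y}],
      {in A, forall v, exists2 x, x \notin A :|: B & leaf_at v x}
    & forall x, x \notin A :|: B ->
        (exists2 v, v \in A & leaf_at v x)
        \/ (exists w y, [/\ w \in B, y \notin A :|: B
                          & pendant_triangle_at w x y])].

Definition cameron_walker : Prop :=
  [/\ connected_on [set: V], ~ star, ~ star_triangle
    & exists A B : {set V}, cameron_walker_parts A B].

End Graphs.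

Section KrullDimension.
Variable R : comNzRingType.

(* P_0 < P_1 < ... < P_d, of length d. *)
Definition prime_chain (d : nat) (P : 'I_d.+1 -> prime_idealr R) : Prop :=
  forall i j : 'I_d.+1, (i < j)%N ->
    {subset (P i : {pred R}) <= (P j : {pred R})} /\
    exists2 x, x \in (P j : {pred R}) & x \notin (P i : {pred R}).

Definition is_krull_dim (d : nat) : Prop :=
  (exists P : 'I_d.+1 -> prime_idealr R, prime_chain P) /\
  (forall e (P : 'I_e.+1 -> prime_idealr R), prime_chain P -> (e <= d)%N).

End KrullDimension.

(* In this section [I] is meant to be a homogeneous ideal of S = K[x_1..x_n]. *)
Section Hilbert.
Variables (K : fieldType) (n : nat) (I : idealr {mpoly K[n]}).

(* [r] is the dimension of the K-vector space (S/I)_k, the image of S_k in S/I: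
   there are r forms of degree k whose classes are a K-basis of it. *)
Definition is_graded_dim (k r : nat) : Prop :=
  exists2 b : 'I_r -> {mpoly K[n]}, forall i, b i \is k.-homog
  & forall p : {mpoly K[n]}, p \is k.-homog ->
      exists! c : 'rV[K]_r,
        \pi_{ideal_quot I} p = \pi_{ideal_quot I} (\sum_i c 0 i *: b i).

Definition is_hilbert_fun (H : nat -> nat) : Prop :=
  forall k, is_graded_dim k (H k).

(* h(t) = (1 - t)^d * sum_k (H k) t^k as formal power series. *)
Definition is_h_poly (d : nat) (h : {poly int}) : Prop :=
  h != 0 /\
  exists2 H, is_hilbert_fun H &
    forall k, h`_k = \sum_(i < k.+1) ((1 - 'X) ^+ d)`_(k - i) * (H i)%:Z.

(* [(size h).-1] is the degree of the nonzero polynomial [h]. *)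
Definition is_a_invariant (a : int) : Prop :=
  exists d h, [/\ is_krull_dim {ideal_quot I} d, is_h_poly d h
                & a = (size h).-1%:Z - d%:Z].

End Hilbert.

Section EdgeIdeal.
Variables (K : fieldType) (n : nat) (G : sgraph 'I_n).

Definition edge_ideal_mem (p : {mpoly K[n]}) : Prop :=
  exists q : 'I_n * 'I_n -> {mpoly K[n]},
    p = \sum_(e | G e.1 e.2) q e * ('X_e.1 * 'X_e.2).

Definition edge_ideal : {pred {mpoly K[n]}} := fun p => `[< edge_ideal_mem p >].

Lemma edge_ideal_closed : idealr_closed edge_ideal.
Proof.
split.
- apply/asboolP; exists (fun=> 0).
  by rewrite big1 // => e _; rewrite mul0r.
- apply/negP => /asboolP[q /(congr1 (meval (fun=> 0)))].
  rewrite meval1 raddf_sum big1 => [/eqP|e _]; first by rewrite oner_eq0.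
  by rewrite /= !mevalM !mevalXU !mulr0.
- move=> a u v /asboolP[p ->] /asboolP[q ->]; apply/asboolP.
  exists (fun e => a * p e + q e).
  rewrite mulr_sumr -big_split; apply: eq_bigr => e _ /=.
  by rewrite mulrDl -mulrA.
Qed.

HB.instance Definition _ :=
  isIdealr.Build {mpoly K[n]} edge_ideal edge_ideal_closed.

End EdgeIdeal.

Arguments edge_ideal K {n} G.

(* Main.v *)
From HB Require Import structures.
Require Import Defs.
From mathcomp Require Import all_boot all_order all_algebra.
From mathcomp Require Import generic_quotient ring_quotient boolp mpoly.

(** Monomials with independent support form a basis of the quotient of the
    polynomial ring by the edge ideal ([edge_idealP]). Its Hilbert series is
    therefore the sum of [(t / (1 - t))^#|S|] over the independent sets [S], and
    its Krull dimension [d] is the largest size of an independent set. So the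
    h-polynomial is the sum of [t^#|S| (1 - t)^(d - #|S|)]; its degree is at
    most [d], and its coefficient at [t^d] is a sum of signs, one for each
    independent set. The a-invariant is 0 as soon as this coefficient is
    nonzero, for which it suffices that the number of independent sets is odd
    ([size_hpoly]).

    In a Cameron-Walker graph that number is odd ([odd_indep]). With the
    bipartition [A], [B], consider the following involution on independent sets
    [S]. If [S] misses a vertex of [A], a leaf at one missing vertex is added
    or removed. If [S] contains [A], it contains no leaf at [A], and no vertex
    of [B] either, since by connectedness each vertex of [B] has a neighbour in
    [A]; then in every pendant triangle the two vertices of degree 2 are
    exchanged. As these two vertices are adjacent, the only fixed point is [A].

    For the Krull dimension, an independent set [S] gives a chain of [#|S|.+1]
    primes, generated by the variables outside a shrinking subset of [S]
    ([edge_ideal_dim_ge]). Conversely, pick an element in each successive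
    difference of a chain of [e.+1] primes: no nontrivial linear combination of
    their monomials lies in the smallest prime ([prime_chain_free]). The [N^e]
    monomials with exponents below [N] are thus linearly independent, while
    their degrees are linear in [N], and the elements of degree at most [M]
    span a space of dimension at most a constant times [(M + 1)^d]. Letting [N]
    grow gives [e <= d] ([edge_ideal_dim_le]). *)

Set Implicit Arguments.
Unset Strict Implicit.
Unset Printing Implicit Defensive.

Import GRing.Theory.

Local Open Scope ring_scope.
Local Open Scope quotient_scope.

(** * Independent sets *)

Section Combinatorics.
Variables (V : finType) (G : sgraph V).

(** No two vertices of [S] are adjacent. *)
Definition indep (S : {set V}) : bool :=
  [forall x in S, forall y in S, ~~ G x y].

Lemma indepP (S : {set V}) : reflect {in S &, forall x y, ~~ G x y} (indep S).
Proof.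
apply: (iffP idP) => [/forall_inP h x y xS yS|h].
  by move: (h x xS) => /forall_inP; apply.
by apply/forall_inP => x xS; apply/forall_inP => y yS; apply: h.
Qed.

Lemma indepS (S T : {set V}) : S \subset T -> indep T -> indep S.
Proof.
move=> /subsetP sST /indepP iT; apply/indepP => x y xS yS.
by apply: iT; apply: sST.
Qed.

Lemma indep0 : indep set0.
Proof. by apply/indepP => x y; rewrite inE. Qed.

Lemma odd_card_involution (T : finType) (P : {set T}) (f : T -> T) :
    {in P, forall x, f x \in P} -> {in P, forall x, f (f x) = x} ->
  odd #|P| = odd #|[set x in P | f x == x]|.
Proof.
move=> fP fK; pose r := @enum_rank T.
pose L := [set x in P | r x < r (f x)]%N.
pose U := [set x in P | r (f x) < r x]%N.
have UL : U = f @: L.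
  apply/setP => x; apply/idP/imsetP => [|[y]].
    rewrite inE => /andP[xP lt]; exists (f x); last by rewrite fK.
    by rewrite inE fP // fK.
  by rewrite inE => /andP[yP lt] ->; rewrite inE fP // fK.
have cUL : #|U| = #|L|.
  rewrite UL card_in_imset // => x y; rewrite !inE => /andP[xP _] /andP[yP _] e.
  by rewrite -(fK x) // e fK.
rewrite -(cardsID [set x | f x == x] P) oddD.
have -> : P :&: [set x | f x == x] = [set x in P | f x == x].
  by apply/setP => x; rewrite !inE.
suff -> : #|P :\: [set x | f x == x]| = (#|L| + #|U|)%N.
  by rewrite cUL addnn odd_double addbF.
rewrite -cardsUI.
have -> : L :&: U = set0.
  by apply/setP => x; rewrite !inE; case: ltngtP; rewrite ?andbF.
rewrite cards0 addn0; apply: eq_card => x; rewrite !inE.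
rewrite -(inj_eq (@enum_rank_inj T)) -val_eqE /= /r.
by case: ltngtP; rewrite ?andbF ?andbT ?orbF.
Qed.

Section Parts.
Variables A B : {set V}.
Hypothesis cw : cameron_walker_parts G A B.

(* The vertices of the pendant triangles other than those of [B]. *)
Let T : {set V} := [set x | (x \notin A :|: B) && (deg G x == 2)].

(* The other vertex of [T] in the triangle of [x]. *)
Let mate (x : V) : V :=
  if x \in T then odflt x [pick y in T | G x y] else x.

Lemma leaf_nbh v x z : leaf_at G v x -> G x z -> z = v.
Proof.
move=> /andP[vx /cards1P[c ec]] xz.
have: z \in nbh G x by rewrite inE.
have: v \in nbh G x by rewrite inE adj_sym.
by rewrite ec !inE => /eqP-> /eqP->.
Qed.

Lemma parts_nbhB w : w \in B -> exists2 v, v \in A & G w v.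
Proof.
case: cw => [[dAB /set0Pn[a aA] _] [[_ conn] _ iB] _ _] wB.
have wAB : w \in A :|: B by rewrite inE wB orbT.
have aAB : a \in A :|: B by rewrite inE aA.
case/connectP: (conn w a wAB aAB) => [[|z p] /=].
  by move=> _ e; move: (disjointFr dAB aA); rewrite e wB.
case/andP => /and3P[_ zAB wz] _ _; exists z => //.
move: zAB; rewrite inE => /orP[//|zB].
by move: (iB w z wB zB); rewrite wz.
Qed.

Lemma mateP x : x \in T ->
  [/\ mate x \in T, G x (mate x), {in T, forall z, G x z -> z = mate x}
    & {in A, forall z, ~~ G x z}].
Proof.
move=> xT; have := xT; rewrite inE => /andP[xN /eqP dx].
have [[dAB _ _] _ _ rest] := cw.
case: (rest x xN) => [[v _ /andP[_ /eqP]]|[w [y [wB yN]]]]; first by rewrite dx.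
case/and5P=> wx wy xy _ /andP[dy _].
have yT : y \in T by rewrite inE yN.
have wN : w \notin T by rewrite !inE wB orbT.
have nx : nbh G x = [set w; y].
  apply/esym/eqP; rewrite eqEcard; apply/andP; split.
    by apply/subsetP => z; rewrite !inE => /orP[] /eqP->; rewrite // adj_sym.
  rewrite cards2 (_ : w != y) ?[#|_|]dx //.
  by apply: contraNneq wN => ->.
have Tz z : z \in T -> G x z -> z = y.
  move=> zT xz; have: z \in nbh G x by rewrite inE.
  rewrite nx !inE => /orP[/eqP e|/eqP//].
  by move: wN; rewrite -e zT.
have -> : mate x = y.
  rewrite /mate xT; case: pickP => [z /andP[zT xz]|/(_ y)] /=.
    exact: Tz.
  by rewrite yT xy.
split=> // z zA; apply/negP => xz; have: z \in nbh G x by rewrite inE.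
rewrite nx !inE => /orP[] /eqP e.
  by move: (disjointFr dAB zA); rewrite e wB.
by move: yN; rewrite inE -e zA.
Qed.

Lemma mateK : involutive mate.
Proof.
move=> x; case: (boolP (x \in T)) => xT; last first.
  by rewrite /mate (negbTE xT) (negbTE xT).
have [mT xm _ _] := mateP xT; have [_ _ u _] := mateP mT.
by apply/esym/u; rewrite // adj_sym.
Qed.

Lemma mate_notin x : x \notin T -> mate x = x.
Proof. by rewrite /mate => /negbTE->. Qed.

Lemma mate_inA x : (mate x \in A) = (x \in A).
Proof.
case: (boolP (x \in T)) => [xT|/mate_notin-> //].
have [mT _ _ _] := mateP xT; move: xT mT.
by rewrite !inE !negb_or -!andbA => /and3P[/negbTE-> _ _] /and3P[/negbTE-> _ _].
Qed.

Lemma mate_inT x : (mate x \in T) = (x \in T).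
Proof.
case: (boolP (x \in T)) => xT; first by case: (mateP xT).
by rewrite mate_notin // (negbTE xT).
Qed.

(** A vertex of [B] has a neighbour in [A], and so has a leaf. *)
Lemma indep_sub_AT S : indep S -> A \subset S -> S \subset A :|: T.
Proof.
move=> /indepP iS /subsetP AS; apply/subsetP => x xS; rewrite inE.
case: (boolP (x \in A)) => //= xA.
case: (boolP (x \in B)) => xB.
  have [v vA xv] := parts_nbhB xB.
  by move: (iS x v xS (AS v vA)); rewrite xv.
have xN : x \notin A :|: B by rewrite inE negb_or xA.
have [_ _ _ rest] := cw.
case: (rest x xN) => [[v vA /andP[vx _]]|[w [y [_ _]]]].
  by move: (iS v x (AS v vA) xS); rewrite vx.
by case/and5P => _ _ _ dx _; rewrite inE xN.
Qed.

(* A leaf at [v]; the default value [v] is not used for [v] in [A]. *)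
Let leaf v := odflt v [pick x | (x \notin A :|: B) && leaf_at G v x].

Lemma leafP v : v \in A -> leaf v \notin A :|: B /\ leaf_at G v (leaf v).
Proof.
move=> vA; rewrite /leaf; case: pickP => [x /andP[]//|/= no].
by have [_ _ /(_ v vA)[x xN vx] _] := cw; move: (no x); rewrite xN vx.
Qed.

Let toggle x (S : {set V}) := if x \in S then S :\ x else x |: S.

Lemma toggle_in x S z : (z \in toggle x S) = (z == x) (+) (z \in S).
Proof.
rewrite /toggle; case: ifP => xS; rewrite !inE.
  by case: eqVneq => [->|]; rewrite ?xS.
by case: eqVneq => [->|]; rewrite ?xS.
Qed.

Lemma toggleK x : involutive (toggle x).
Proof. by move=> S; apply/setP => z; rewrite !toggle_in addbA addbb. Qed.

(* The involution behind [odd_indep]: if [S] misses vertices of [A], the leaf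
   of one of them is added or removed; otherwise mates are exchanged. The choice
   depends on [A :\: S] only, which adding or removing a leaf does not change. *)
Let flip (S : {set V}) : {set V} :=
  if [pick v in A :\: S] is Some v then toggle (leaf v) S
  else mate @^-1: S.

Lemma pick_sub S : ([pick v in A :\: S] == None) = (A \subset S).
Proof.
rewrite -setD_eq0; case: pickP => [v vAS|no].
  by apply/esym/negbTE/set0Pn; exists v.
by apply/esym/eqP/setP => v; rewrite no inE.
Qed.

(** When [S] contains [A], it lies in [A :|: T]; there exchanging mates
    preserves adjacency. *)
Lemma indep_flip S : indep S -> indep (flip S).
Proof.
move=> iS; rewrite /flip; move: (pick_sub S); case: pickP => [v vAS _|_].
  move: vAS; rewrite inE => /andP[vS vA].
  have [xN vx] := leafP vA; set x := leaf v in xN vx *.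
  rewrite /toggle; case: ifP => xS; first exact: indepS (subsetDl _ _) iS.
  have no z : z \in S -> ~~ G x z.
    by move=> zS; apply/negP => /(leaf_nbh vx) e; rewrite -e zS in vS.
  apply/indepP => a b; rewrite !inE.
  case/predU1P => [->|aS] /predU1P[->|bS].
  - by rewrite adj_irr.
  - exact: no.
  - by rewrite adj_sym no.
  - exact: (indepP _ iS).
rewrite eqxx => /esym AS; have sAT := indep_sub_AT iS AS.
have inAT z : mate z \in S -> (z \in A) || (z \in T).
  by move=> /(subsetP sAT); rewrite inE mate_inA mate_inT.
have iA := subsetP AS.
apply/indepP => a b; rewrite !in_set => aS bS; apply/negP => ab.
case/orP: (inAT a aS) => aX; case/orP: (inAT b bS) => bX.
- by move/indepP: iS => /(_ a b (iA a aX) (iA b bX)); rewrite ab.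
- by have [_ _ _ /(_ a aX)] := mateP bX; rewrite adj_sym ab.
- by have [_ _ _ /(_ b bX)] := mateP aX; rewrite ab.
- have [_ _ /(_ b bX ab) e _] := mateP aX.
  move/indepP: iS => /(_ _ _ bS aS); rewrite e mateK -e.
  by rewrite ab.
Qed.

Lemma flipK S : indep S -> flip (flip S) = S.
Proof.
move=> iS; rewrite {2}/flip.
case ep: [pick v in A :\: S] => [v|].
  move: (ep); case: pickP => // u vAS [eu]; move: vAS; rewrite {u}eu.
  rewrite inE => /andP[vS vA]; have [xN vx] := leafP vA.
  have eAS : A :\: toggle (leaf v) S = A :\: S.
    apply/setP => z; rewrite !in_setD toggle_in.
    case: eqVneq => //= ->; move: xN; rewrite inE negb_or.
    by case/andP => /negbTE->; rewrite !andbF.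
  by rewrite /flip eAS ep toggleK.
have AS : A \subset S by rewrite -pick_sub ep.
have /eqP ep' : [pick v in A :\: (mate @^-1: S)] == None.
  rewrite pick_sub; apply/subsetP => z zA.
  by rewrite inE (subsetP AS) ?mate_inA.
by rewrite /flip ep'; apply/setP => z; rewrite !inE mateK.
Qed.

(** [A] is the only independent set fixed by [flip]: an independent set that
    is stable under the exchange of mates avoids [T]. *)
Lemma odd_indep_parts : odd #|[set S | indep S]|.
Proof.
rewrite (@odd_card_involution _ _ flip); first last.
- by move=> S; rewrite inE => /flipK.
- by move=> S; rewrite !inE => /indep_flip.
rewrite (_ : [set S in _ | _] = [set A]) ?cards1 //.
have iA : indep A by case: cw => [_ [_ iA _] _ _]; apply/indepP.
apply/setP => S; rewrite !inE; apply/andP/eqP => [[iS]|->].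
  rewrite /flip; move: (pick_sub S); case: pickP => [v _ _ /eqP|_].
    by move/setP/(_ (leaf v)); rewrite toggle_in eqxx; case: (_ \in S).
  rewrite eqxx => /esym AS /eqP fS; apply/eqP; rewrite eqEsubset AS andbT.
  apply/subsetP => x xS; move: (subsetP (indep_sub_AT iS AS) x xS).
  rewrite inE => /orP[//|xT]; have [_ xm _ _] := mateP xT.
  have mS : mate x \in S by rewrite -fS inE mateK.
  by move/indepP: iS => /(_ _ _ xS mS); rewrite xm.
split=> //; rewrite /flip; move: (pick_sub A); rewrite subxx.
by case: pickP => // _ _; apply/eqP/setP => z; rewrite inE mate_inA.
Qed.

End Parts.

Lemma odd_indep : cameron_walker G -> odd #|[set S | indep S]|.
Proof. by case=> _ _ _ [A [B cw]]; apply: odd_indep_parts cw. Qed.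

End Combinatorics.

(** * The edge ideal and its Hilbert function *)

Section EdgeIdealTheory.
Variables (K : fieldType) (n : nat) (G : sgraph 'I_n).
Implicit Types (p q : {mpoly K[n]}) (m : 'X_{1..n}) (S : {set 'I_n}).

(** The set of the variables that divide a monomial. *)
Definition msuppv m : {set 'I_n} := [set i | m i != 0%N].

Lemma msuppv1 i : msuppv U_(i) = [set i].
Proof. by apply/setP => j; rewrite !inE mnm1E (eq_sym j); case: (i == j). Qed.

Lemma msuppvD m1 m2 : msuppv (m1 + m2) = msuppv m1 :|: msuppv m2.
Proof. by apply/setP => j; rewrite !inE mnmDE addn_eq0 negb_and. Qed.

(** In other words, the monomials with independent support are a basis of the
    quotient by the edge ideal. *)
Lemma edge_idealP p :
  reflect (forall m, indep G (msuppv m) -> p@_m = 0) (p \in edge_ideal K G).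
Proof.
apply: (iffP idP) => [/asboolP[q ->] m im|h].
  rewrite raddf_sum big1 //= => -[a b] /= ab.
  apply/eqP; rewrite mcoeff_eq0 -mpolyXD; rewrite (perm_mem (msuppMX _ _)).
  apply/mapP => -[m' _ e]; move/indepP: im => /(_ a b).
  rewrite e !msuppvD !msuppv1 !inE !eqxx !orbT /= ab.
  by move=> /(_ isT isT).
rewrite [p]mpolyE big_seq; apply: rpred_sum => m mp.
have : ~~ indep G (msuppv m).
  by apply/negP => /h /eqP; rewrite mcoeff_eq0 mp.
case/forall_inPn => a; rewrite inE => ma /forall_inPn[b].
rewrite inE negbK => mb ab.
have le : (U_(a) + U_(b) <= m)%MM.
  apply/mnm_lepP => i; rewrite mnmDE !mnm1E.
  case: (eqVneq a i) => [<-|_]; case: (eqVneq b _) => [e|_] //=.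
  - by move: ab; rewrite e adj_irr.
  - by rewrite lt0n.
  - by rewrite -e lt0n.
apply/asboolP.
exists (fun e => if e == (a, b) then
    p@_m *: 'X_[m - (U_(a) + U_(b))] else 0).
rewrite (bigD1 (a, b)) //= eqxx big1 => [|e /andP[_ /negbTE->]]; last first.
  by rewrite mul0r.
by rewrite addr0 -scalerAl -!mpolyXD submK.
Qed.

Lemma eq_pi_edge p q :
  \pi_{ideal_quot (edge_ideal K G)} p = \pi_{ideal_quot (edge_ideal K G)} q
    <-> p - q \in edge_ideal K G.
Proof.
rewrite (Quotient.idealrBE (edge_ideal K G : idealr _)).
by split=> [->|/eqP].
Qed.

(** The graded component of degree [k] of the quotient by the edge ideal has a
    basis indexed by any set that parametrizes bijectively the monomials of
    degree [k] with independent support. *)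
Lemma edge_ideal_graded_dim k (T : finType) (P : {set T}) (g : T -> 'X_{1..n}) :
    {in P &, injective g} ->
    (forall m, (mdeg m == k) && indep G (msuppv m) <->
               exists2 t, t \in P & g t = m) ->
  is_graded_dim (edge_ideal K G) k #|P|.
Proof.
move=> g_inj gP.
pose b (i : 'I_#|P|) : {mpoly K[n]} := 'X_[g (enum_val i)].
have b_lin (c : 'rV[K]_#|P|) i :
    (\sum_j c 0 j *: b j)@_(g (enum_val i)) = c 0 i.
  rewrite raddf_sum (bigD1 i) //= big1 => [|j ji].
    by rewrite mcoeffZ mcoeffX eqxx mulr1 addr0.
  rewrite mcoeffZ mcoeffX (inj_in_eq g_inj) ?enum_valP //.
  by rewrite (inj_eq enum_val_inj) (negbTE ji) mulr0.
exists b => [i|p hp].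
  rewrite dhomogX.
  have /gP/andP[] // : exists2 t, t \in P & g t = g (enum_val i).
  by exists (enum_val i); rewrite ?enum_valP.
exists (\row_i p@_(g (enum_val i))); split=> [|c].
  apply/eq_pi_edge/edge_idealP => m im; rewrite mcoeffB.
  have [dm|dm] := eqVneq (mdeg m) k.
    have /gP[t tP <-] : (mdeg m == k) && indep G (msuppv m) by rewrite dm eqxx.
    by rewrite -(enum_rankK_in tP tP) b_lin mxE subrr.
  rewrite (dhomog_nemf_coeff hp) // raddf_sum big1 ?subr0 //= => j _.
  rewrite mcoeffZ mcoeffX; case: eqP => [e|]; last by rewrite mulr0.
  have /gP/andP[/eqP dk] : exists2 t, t \in P & g t = m.
    by exists (enum_val j); rewrite ?enum_valP.
  by rewrite dk eqxx in dm.
move/eq_pi_edge/edge_idealP => h; apply/rowP => i; rewrite mxE.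
apply/eqP; rewrite -(b_lin c i) -subr_eq0 -mcoeffB h //.
have /gP/andP[] // : exists2 t, t \in P & g t = g (enum_val i).
by exists (enum_val i); rewrite ?enum_valP.
Qed.

End EdgeIdealTheory.

(** * The h-polynomial *)

Section HPolynomial.
Variables (K : fieldType) (n : nat) (G : sgraph 'I_n).

(** The exponent vector of a monomial all of whose exponents are at most
    [N]. *)
Definition boxmon N (f : {ffun 'I_n -> 'I_N.+1}) : 'X_{1..n} :=
  [multinom (f i : nat) | i < n].

Lemma boxmon_inj N : injective (@boxmon N).
Proof.
move=> f g /mnmP e; apply/ffunP => i; apply/val_inj.
by have := e i; rewrite !mnmE.
Qed.

(** The monomials of degree [k] with independent support, among those with all
    exponents at most [N]. *)
Definition indep_box N k : {set {ffun 'I_n -> 'I_N.+1}} :=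
  [set f | (mdeg (boxmon f) == k) && indep G (msuppv (boxmon f))].

Lemma leq_mdeg (m : 'X_{1..n}) i : (m i <= mdeg m)%N.
Proof. by rewrite mdegE (bigD1 i) //= leq_addr. Qed.

Lemma boxmon_surj N (m : 'X_{1..n}) :
  (forall i, m i <= N)%N -> exists f, @boxmon N f = m.
Proof.
move=> mN; exists [ffun i => inord (m i)].
by apply/mnmP => i; rewrite mnmE ffunE inordK // ltnS.
Qed.

Lemma indep_boxP N k : (k <= N)%N -> forall m,
  (mdeg m == k) && indep G (msuppv m) <->
  exists2 f, f \in indep_box N k & boxmon f = m.
Proof.
move=> kN m; split=> [mP|[f]]; last by rewrite inE => fP <-.
have [|f fm] := @boxmon_surj N m.
  by case/andP: mP => /eqP mk _ i; rewrite (leq_trans (leq_mdeg m i)) ?mk.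
by exists f; rewrite ?inE fm.
Qed.

(** The Hilbert function of the quotient by the edge ideal: a monomial of
    degree [k] has exponents at most [k]. *)
Definition hilb k := #|indep_box k k|.

Lemma card_indep_box N k : (k <= N)%N -> #|indep_box N k| = hilb k.
Proof.
move=> kN; rewrite /hilb !cardE.
rewrite -(size_map (@boxmon N)) -[RHS](size_map (@boxmon k)).
apply/perm_size/uniq_perm;
  rewrite ?(map_inj_uniq (@boxmon_inj _)) ?enum_uniq //.
move=> m; apply/mapP/mapP => -[f]; rewrite mem_enum => fP e.
- have : exists2 f, f \in indep_box N k & boxmon f = m by exists f.
  move=> /(indep_boxP kN)/(indep_boxP (leqnn k))[g gP ge].
  by exists g; rewrite ?mem_enum.
- have : exists2 f, f \in indep_box k k & boxmon f = m by exists f.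
  move=> /(indep_boxP (leqnn k))/(indep_boxP kN)[g gP ge].
  by exists g; rewrite ?mem_enum.
Qed.

Lemma hilbP : is_hilbert_fun (edge_ideal K G) hilb.
Proof.
move=> k; apply: (@edge_ideal_graded_dim _ _ _ _ _ _ (@boxmon k)).
  by move=> f g _ _; apply: boxmon_inj.
exact: indep_boxP.
Qed.

(** The part of the Hilbert series carried by the monomials with all exponents
    at most [N]; it agrees with the full series up to degree [N]. *)
Definition box_series N : {poly int} :=
  \sum_(f : {ffun 'I_n -> 'I_N.+1} | indep G (msuppv (boxmon f)))
    'X^(mdeg (boxmon f)).

Lemma coef_box_series N k : (k <= N)%N -> (box_series N)`_k = (hilb k)%:Z.
Proof.
move=> kN; rewrite coef_sum -(card_indep_box kN) -sum1_card.
rewrite -natz natr_sum [RHS]big_mkcond [LHS]big_mkcond /=.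
apply: eq_bigr => f _; rewrite inE coefXn eq_sym.
by case: (indep G _); case: eqP.
Qed.

(** The polynomial [X + ... + X^N]. *)
Definition geom N : {poly int} := \sum_(j < N.+1 | j != 0 :> nat) 'X^j.

(** The monomials are sorted by their support; each variable of the support
    contributes a factor [X + ... + X^N]. *)
Lemma box_seriesE N :
  box_series N = \sum_(S | indep G S) geom N ^+ #|S|.
Proof.
rewrite /box_series (partition_big (fun f => msuppv (boxmon f)) (indep G)) //=.
apply: eq_bigr => S iS.
pose Q (i : 'I_n) (j : 'I_N.+1) := (j != 0 :> nat) == (i \in S).
rewrite (eq_bigl (mem (family Q))) => [|f]; last first.
  apply/andP/familyP => [[_ /eqP e] i|h].
    by rewrite unfold_in /Q -e inE mnmE.
  have -> : msuppv (boxmon f) = S.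
    apply/setP => i; rewrite inE mnmE.
    by move: (h i); rewrite unfold_in => /eqP.
  by rewrite iS eqxx.
rewrite (eq_bigr (fun f : {ffun 'I_n -> 'I_N.+1} => \prod_i 'X^(f i)))
  => [|f _]; last first.
  by rewrite prodrXr mdegE; congr ('X^_); apply: eq_bigr => i _; rewrite mnmE.
rewrite -(bigA_distr_big_dep _ (fun _ (j : 'I_N.+1) => 'X^j)) /=.
rewrite -prodr_const [RHS]big_mkcond; apply: eq_bigr => i _.
case: ifP => iS'; first by apply: eq_bigl => j; rewrite /Q iS' eqb_id.
rewrite (eq_bigl (pred1 ord0)) ?big_pred1_eq ?expr0 // => j.
by rewrite /Q iS' eqbF_neg negbK.
Qed.

Lemma geom_telescope N : (1 - 'X) * geom N = 'X - 'X^(N.+1).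
Proof.
rewrite /geom big_mkcond big_ord_recl /= add0r.
elim: N => [|N IH]; first by rewrite big_ord0 mulr0 expr1 subrr.
by rewrite big_ord_recr /= mulrDr IH mulrBl mul1r -exprS addrA subrK.
Qed.

Lemma exp_geom N s :
  exists r, ((1 - 'X) * geom N) ^+ s = 'X^s + 'X^(N.+1) * r.
Proof.
rewrite geom_telescope; elim: s => [|s [r IH]].
  by exists 0; rewrite mulr0 addr0.
exists (r * ('X - 'X^(N.+1)) - 'X^s); rewrite exprSr IH mulrDl.
rewrite mulrBr -exprSr -addrA; congr (_ + _).
by rewrite [RHS]mulrBr mulrA ['X^(N.+1) * 'X^s]mulrC addrC.
Qed.

(** The numerator of the Hilbert series over [(1 - X)^d]: the monomials with
    support [S] have generating series [(X / (1 - X))^#|S|]. *)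
Definition hpoly d : {poly int} :=
  \sum_(S | indep G S) 'X^#|S| * (1 - 'X) ^+ (d - #|S|).

Section Degree.
Variable d : nat.
Hypothesis dmax : forall S, indep G S -> (#|S| <= d)%N.

Lemma coef_hpoly k :
  (hpoly d)`_k = \sum_(i < k.+1) ((1 - 'X) ^+ d)`_(k - i) * (hilb i)%:Z.
Proof.
transitivity ((1 - 'X) ^+ d * box_series k)`_k; last first.
  rewrite coefMr; apply: eq_bigr => i _; congr (_ * _).
  by rewrite coef_box_series // -ltnS.
rewrite box_seriesE mulr_sumr !coef_sum; apply: eq_bigr => S iS.
have [r e] := exp_geom k #|S|.
rewrite -{2}(subnK (dmax iS)) exprD -mulrA -exprMn e mulrDr.
by rewrite mulrC coefD mulrCA coefXnM ltnSn addr0.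
Qed.

Lemma size_exp_1subX m : size ((1 - 'X : {poly int}) ^+ m) = m.+1.
Proof.
rewrite -opprB exprNn -signr_odd mulr_sign -polyC1.
by case: odd; rewrite ?size_polyN size_exp_XsubC.
Qed.

Lemma coef_exp_1subX m : ((1 - 'X : {poly int}) ^+ m)`_m = (-1) ^+ m.
Proof.
have e : (('X - 1 : {poly int}) ^+ m)`_m = 1.
  have /monicP : ('X - 1%:P : {poly int}) ^+ m \is monic.
    by rewrite monic_exp ?monicXsubC.
  by rewrite /lead_coef size_exp_XsubC /= polyC1.
rewrite -opprB [in LHS]exprNn -signr_odd mulr_sign -[in RHS]signr_odd.
by case: odd; rewrite ?coefN e.
Qed.

(** Modulo 2 the top coefficient counts the independent sets. *)
Lemma size_hpoly : odd #|[set S | indep G S]| -> size (hpoly d) = d.+1.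
Proof.
move=> od; apply/eqP; rewrite eqn_leq; apply/andP; split.
  apply: leq_trans (size_sum _ _ _) _; apply/bigmax_leqP => S iS.
  apply: leq_trans (size_polyMleq _ _) _.
  by rewrite size_polyXn size_exp_1subX addSn /= addnS subnKC // dmax.
suff: (hpoly d)`_d != 0 by apply: contraNT; rewrite -leqNgt => /leq_sizeP->.
suff e : ((hpoly d)`_d)%:~R = 1 :> 'F_2.
  by apply: contra_eq_neq e => ->; rewrite eq_sym oner_eq0.
rewrite coef_sum rmorph_sum /= (eq_bigr (fun=> 1)) => [|S iS]; last first.
  rewrite coefXnM ltnNge dmax //= coef_exp_1subX rmorphXn rmorphN1.
  by rewrite (_ : -1 = 1) ?expr1n //; apply/val_inj.
rewrite sumr_const -(odd_double_half #|_|) mulrnDr -mul2n mulrnA.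
have -> : 1 *+ 2 = 0 :> 'F_2 by apply/val_inj.
have -> : #|[pred S | indep G S]| = #|[set S | indep G S]|.
  by apply: eq_card => S; rewrite !inE.
by rewrite od mul0rn addr0.
Qed.

End Degree.
End HPolynomial.

(** * The Krull dimension *)

Section LowerBound.
Variables (K : fieldType) (n : nat) (G : sgraph 'I_n).
Local Notation R := {ideal_quot (edge_ideal K G)}.

(** Setting the variables outside [S] to zero. *)
Definition restrict (S : {set 'I_n}) : {mpoly K[n]} -> {mpoly K[n]} :=
  comp_mpoly [tuple if i \in S then 'X_i else 0 | i < n].

HB.instance Definition _ S := GRing.RMorphism.on (restrict S).

Lemma coef_restrict S (p : {mpoly K[n]}) m :
  (restrict S p)@_m = if msuppv m \subset S then p@_m else 0.
Proof.
have rX m' : restrict S 'X_[m'] = if msuppv m' \subset S then 'X_[m'] else 0.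
  rewrite /restrict comp_mpolyX; case: ifP => [/subsetP sS|/negbT/subsetPn[i]].
    rewrite [RHS]mpolyXE_id; apply: eq_bigr => i _; rewrite tnth_mktuple.
    case: ifP => // iS; suff -> : m' i = 0%N by rewrite !expr0.
    by apply/eqP; apply: contraFT iS => mi; apply: sS; rewrite inE.
  rewrite inE => mi iS; rewrite (bigD1 i) //= tnth_mktuple (negbTE iS).
  by rewrite expr0n (negbTE mi) mul0r.
have cX m' : (restrict S (p@_m' *: 'X_[m']))@_m =
    if msuppv m \subset S then (p@_m' *: 'X_[m'])@_m else 0.
  rewrite [restrict S _]comp_mpolyZ [comp_mpoly _ _]rX !mcoeffZ.
  rewrite (fun_if (mcoeff m)) mcoeff0.
  rewrite mcoeffX; case: (eqVneq m' m) => [->|_].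
    by case: ifP => _; rewrite ?mulr0.
  by case: ifP; case: ifP; rewrite ?mulr0.
rewrite {1 2}[p]mpolyE rmorph_sum !raddf_sum /=.
rewrite (eq_bigr _ (fun m' _ => cX m')).
by case: ifP => // _; rewrite big1.
Qed.

Lemma restrict_eq0P (S : {set 'I_n}) (p : {mpoly K[n]}) :
  reflect (forall m, msuppv m \subset S -> p@_m = 0) (restrict S p == 0).
Proof.
apply: (iffP eqP) => [e m mS|h].
  by have := coef_restrict S p m; rewrite mS e mcoeff0.
apply/mpolyP => m; rewrite coef_restrict mcoeff0.
by case: ifP => // /h.
Qed.

Lemma restrict_edge_ideal (S : {set 'I_n}) (p : {mpoly K[n]}) :
  indep G S -> p \in edge_ideal K G -> restrict S p = 0.
Proof.
move=> iS /edge_idealP pI; apply/eqP/restrict_eq0P => m mS.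
by apply: pI; apply: indepS iS.
Qed.

(** The prime ideal of the quotient by the edge ideal generated by the
    variables outside an independent set, as the kernel of [restrict S]; by
    [face_primeE] the choice of a representative is immaterial. *)
Definition face_prime (S : {set 'I_n}) (iS : indep G S) : {pred R} :=
  fun x => restrict S (repr x) == 0.

Lemma face_primeE (S : {set 'I_n}) (iS : indep G S) (p : {mpoly K[n]}) :
  (\pi_R p \in face_prime iS) = (restrict S p == 0).
Proof.
rewrite unfold_in /face_prime -subr_eq0.
suff -> : restrict S (repr (\pi_R p)) = restrict S p by rewrite subr_eq0.
apply/eqP; rewrite -subr_eq0 -rmorphB; apply/eqP.
apply: restrict_edge_ideal => //.
by apply/eq_pi_edge; rewrite reprK.
Qed.

Lemma face_prime_closed (S : {set 'I_n}) (iS : indep G S) :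
  idealr_closed (face_prime iS).
Proof.
split.
- by rewrite -[0](rmorph0 \pi_R) face_primeE rmorph0.
- by rewrite -[1](rmorph1 \pi_R) face_primeE rmorph1 oner_eq0.
move=> a u v; rewrite -[a]reprK -[u]reprK -[v]reprK -rmorphM -rmorphD.
rewrite !face_primeE => /eqP eu /eqP ev.
by rewrite rmorphD rmorphM /= eu ev mulr0 addr0.
Qed.

Lemma face_prime_prime (S : {set 'I_n}) (iS : indep G S) :
  prime_idealr_closed (face_prime iS).
Proof.
move=> u v; rewrite -[u]reprK -[v]reprK -rmorphM !face_primeE rmorphM.
by rewrite mulf_eq0.
Qed.

HB.instance Definition _ S iS :=
  isIdealr.Build R (@face_prime S iS) (face_prime_closed iS).
HB.instance Definition _ S iS :=
  isPrimeIdealrClosed.Build R (@face_prime S iS) (@face_prime_prime S iS).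

(** Shrinking an independent set by one vertex at a time gives a chain of
    primes. *)
Lemma edge_ideal_dim_ge (S : {set 'I_n}) : indep G S ->
  exists P : 'I_#|S|.+1 -> prime_idealr R, prime_chain P.
Proof.
move=> iS; (* [F j] consists of [S] without its first [j] elements. *)
pose F j := [set x in S | j <= index x (enum S)]%N.
have iF j : indep G (F j) by apply: indepS iS; apply/subsetP => x /setIdP[].
exists (fun j : 'I__ => face_prime (iF j) : prime_idealr R).
move=> i j ij; split=> [u|].
  rewrite -[u]reprK !face_primeE => /restrict_eq0P h.
  apply/restrict_eq0P => m mS; apply: h; apply: subset_trans mS _.
  apply/subsetP => x; rewrite !inE => /andP[-> /=].
  by apply: leq_trans; apply: ltnW.
have iltS : (i < #|S|)%N := leq_trans ij (ltn_ord j).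
pose x := enum_val (Ordinal iltS).
have xi : index x (enum S) = i.
  by rewrite /x /enum_val index_uniq ?enum_uniq // -cardE.
have xS : x \in S by apply: enum_valP.
exists (\pi_R 'X_x); rewrite face_primeE.
  apply/restrict_eq0P => m mS; rewrite mcoeffX; case: eqP => // e.
  have: x \in F j by apply: (subsetP mS); rewrite -e msuppv1 inE.
  by rewrite inE xi leqNgt ij andbF.
apply/restrict_eq0P => /(_ U_(x)%MM); rewrite mcoeffX eqxx msuppv1 sub1set.
by rewrite inE xS xi leqnn => /(_ isT) /eqP; rewrite oner_eq0.
Qed.

End LowerBound.

Section UpperBound.

(** Let [x] be in the larger of two nested primes but not in the smaller one.
    If a polynomial in [x] lies in the smaller prime, its lowest nonzero
    coefficient lies in the larger one; so all the coefficients vanish when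
    none is a nonzero element of the larger prime. *)
Lemma prime_power_sum (R : comNzRingType) (P0 P1 : prime_idealr R) (x : R) N
    (a : 'I_N -> R) :
    {subset (P0 : {pred R}) <= (P1 : {pred R})} ->
    x \in (P1 : {pred R}) -> x \notin (P0 : {pred R}) ->
    (forall j, a j \in (P1 : {pred R}) -> a j = 0) ->
    \sum_(j < N) x ^+ j * a j \in (P0 : {pred R}) ->
  forall j, a j = 0.
Proof.
move=> s01 x1 x0; elim: N a => [|N IH] a a0 aP j; first by case: j.
move: aP; rewrite big_ord_recl expr0 mul1r.
under eq_bigr do rewrite exprS -mulrA; rewrite -mulr_sumr => aP.
have e0 : a ord0 = 0.
  apply: a0; move/s01: aP; rewrite rpredDr // mulrC; exact: idealMr.
move: aP; rewrite e0 add0r prime_idealrM (negbTE x0) /= => aP.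
case: (unliftP ord0 j) => [k|] -> //.
by apply: (IH (fun j => a (lift ord0 j))) => // i; apply: a0.
Qed.

Variables (K : fieldType) (n : nat) (G : sgraph 'I_n).
Local Notation R := {ideal_quot (edge_ideal K G)}.
Local Notation pi := (\pi_R).

Lemma msizeM_leD (p q : {mpoly K[n]}) :
  (msize (p * q) <= msize p + msize q)%N.
Proof.
have [->|p0] := eqVneq p 0; first by rewrite mul0r msize0.
have [->|q0] := eqVneq q 0; first by rewrite mulr0 msize0.
by rewrite msizeM // leq_pred.
Qed.

Lemma msizeX_le (p : {mpoly K[n]}) j : (msize (p ^+ j) <= j * msize p + 1)%N.
Proof.
elim: j => [|j IH]; first by rewrite expr0 msize1.
rewrite exprS mulSn -addnA.
by apply: leq_trans (msizeM_leD _ _) _; rewrite leq_add2l.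
Qed.

(** Elements of the successive differences of a chain of [e.+1] primes have
    linearly independent monomials modulo the smallest prime. Hence there are,
    for every [N], [N ^ e] independent elements of degree linear in [N]. *)
Lemma prime_chain_free e (P : 'I_e.+1 -> prime_idealr R) : prime_chain P ->
  exists D, forall N, exists (T : finType) (y : T -> {mpoly K[n]}),
    [/\ #|T| = (N ^ e)%N, forall t, (msize (y t) <= (D * N).+1)%N
      & forall c : T -> K,
          pi (\sum_t c t *: y t) \in (P ord0 : {pred R}) -> forall t, c t = 0].
Proof.
elim: e P => [|e IH] P cP.
  exists 0%N => N; exists unit, (fun=> 1); split=> [|t|c].
  - by rewrite card_unit.
  - by rewrite msize1.
  rewrite (big_pred1 tt) => [|[]//]; case: (eqVneq (c tt) 0) => [c0 _ []//|nz].
  move=> /(idealMr (pi (c tt)^-1%:MP)); rewrite -rmorphM /= -mul_mpolyC.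
  by rewrite mulrA -mpolyCM mulVf // mul1r rmorph1 idealr1.
have [|D IHD] := IH (fun i => P (lift ord0 i)).
  by move=> i j ij; apply: cP.
have [] := cP ord0 (lift ord0 ord0) isT.
set P0 := P ord0; set P1 := P _ => s01 [x x1 x0].
pose X : {mpoly K[n]} := repr x.
have piX : pi X = x by rewrite reprK.
exists (D + (msize X).+1)%N => N; have [T [y [cT sy iy]]] := IHD N.
exists ('I_N * T)%type, (fun jt : 'I_N * T => X ^+ jt.1 * y jt.2); split.
- by rewrite card_prod card_ord cT expnS.
- move=> [j t] /=; apply: leq_trans (msizeM_leD _ _) _.
  apply: leq_trans (leq_add (msizeX_le _ _) (sy t)) _.
  have jN : (j < N)%N := ltn_ord j.
  rewrite addnS ltnS mulnDl addnC leq_add2l mulSn (addnC N) leq_add //.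
    by rewrite mulnC leq_mul2l (ltnW jN) orbT.
  exact: leq_ltn_trans jN.
move=> c cP0 [j t].
pose a (j : 'I_N) := pi (\sum_t c (j, t) *: y t).
have ca i : a i \in (P1 : {pred R}) -> forall t, c (i, t) = 0.
  exact: (iy (fun t => c (i, t))).
have a0 i : a i \in (P1 : {pred R}) -> a i = 0.
  by move/ca => c0; rewrite /a big1 ?rmorph0 // => u _; rewrite c0 scale0r.
suff z : a j = 0 by apply: ca; rewrite z rpred0.
apply: (prime_power_sum s01 x1 x0 a0).
rewrite (_ : \sum_i _ = pi (\sum_jt c jt *: (X ^+ jt.1 * y jt.2))) //.
have -> : \sum_jt c jt *: (X ^+ jt.1 * y jt.2) =
    \sum_(i < N) \sum_u c (i, u) *: (X ^+ i * y u).
  by rewrite pair_bigA; apply: eq_bigr => -[].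
rewrite rmorph_sum; apply: eq_bigr => i _.
rewrite -piX -rmorphXn -rmorphM /= mulr_sumr; congr (pi _).
by apply: eq_bigr => u _; rewrite scalerAr.
Qed.

(** The number of these monomials is the value at 1 of [box_series G M]. *)
Lemma card_indep_support d M : (forall S, indep G S -> #|S| <= d)%N ->
  (#|[set f : {ffun 'I_n -> 'I_M.+1} | indep G (msuppv (boxmon f))]|
     <= #|[set S | indep G S]| * M.+1 ^ d)%N.
Proof.
move=> dmax; have /(congr1 (horner^~ 1)) := box_seriesE G M.
rewrite /box_series /geom !horner_sum.
under eq_bigr do rewrite hornerXn expr1n.
under [RHS]eq_bigr do (rewrite horner_exp horner_sum;
  under eq_bigr do (rewrite hornerXn expr1n)).
set g := #|[pred j : 'I_M.+1 | j != 0 :> nat]|.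
have gM : (g <= M.+1)%N by rewrite -[X in (_ <= X)%N]card_ord max_card.
rewrite sumr_const.
under eq_bigr do rewrite sumr_const -natrX.
rewrite -natr_sum => /eqP; rewrite Num.Theory.eqr_nat => /eqP e.
rewrite [leqLHS](_ : _ = \sum_(S | indep G S) g ^ #|S|)%N; last first.
  by rewrite -e; apply: eq_card => f; rewrite !inE.
rewrite -sum_nat_const [leqRHS](eq_bigl (indep G)) => [|S]; last by rewrite inE.
apply: leq_sum => S iS.
apply: leq_trans (leq_pexp2l _ (dmax S iS)) => //.
by case: #|S| => // s; rewrite leq_exp2r.
Qed.

(** Elements of bounded degree that are independent modulo the edge ideal are
    no more numerous than the monomials of that degree with independent
    support. *)
Lemma free_card_le (T : finType) (y : T -> {mpoly K[n]}) M :
    (forall t, (msize (y t) <= M.+1)%N) ->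
    (forall c : T -> K, \sum_t c t *: y t \in edge_ideal K G ->
       forall t, c t = 0) ->
  (#|T| <= #|[set f : {ffun 'I_n -> 'I_M.+1} | indep G (msuppv (boxmon f))]|)%N.
Proof.
move=> sy iy; set B := [set f | _]; rewrite leqNgt; apply/negP => lt.
(* The coefficients of the [y t] at the monomials with independent support; a
   row vector in the kernel gives a combination of the [y t] in the ideal. *)
pose A := \matrix_(i < #|T|, j < #|B|) (y (enum_val i))@_(boxmon (enum_val j)).
have : kermx A != 0.
  rewrite kermx_eq0 /row_free; apply: contraTneq lt => <-.
  by rewrite -leqNgt rank_leq_col.
case/rowV0Pn => v /sub_kermxP vA /eqP; apply; apply/rowP => i.
rewrite mxE -(enum_valK i).
apply: (iy (fun t => v 0 (enum_rank t))); apply/edge_idealP => m im.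
rewrite raddf_sum /=.
have [/forallP mM|/forallPn[j]] := boolP [forall i, m i <= M]%N; last first.
  rewrite -ltnNge => mj; rewrite big1 // => t _; rewrite mcoeffZ.
  rewrite [_@_m]memN_msupp_eq0 ?mulr0 //; apply: msize_mdeg_ge.
  by apply: leq_trans (sy t) _; apply: leq_trans mj (leq_mdeg m j).
have [f fm] := boxmon_surj mM.
have fB : f \in B by rewrite inE fm.
have := congr1 (fun r : 'rV_ _ => r 0 (enum_rank_in fB f)) vA.
rewrite !mxE => {2}<-; rewrite (reindex _ (onW_bij _ (@enum_val_bij T))) /=.
apply: eq_bigr => k _; rewrite mxE enum_rankK_in // fm.
by rewrite mcoeffZ enum_valK.
Qed.

Lemma edge_ideal_dim_le d e (P : 'I_e.+1 -> prime_idealr R) :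
  (forall S, indep G S -> #|S| <= d)%N -> prime_chain P -> (e <= d)%N.
Proof.
move=> dmax /prime_chain_free[D hD]; rewrite leqNgt; apply/negP => de.
set C := #|[set S | indep G S]|.
(* [N] is large enough for [N ^ d.+1] to exceed [C * (D.+1 * N) ^ d]. *)
pose N := (C * D.+1 ^ d).+1.
have [T [y [cT sy iy]]] := hD N.
have : (N ^ e <= C * (D * N).+1 ^ d)%N.
  rewrite -cT; apply: leq_trans (card_indep_support _ dmax).
  apply: free_card_le => // c cI; apply: iy.
  have -> : pi (\sum_t c t *: y t) = 0.
    by rewrite -[RHS](rmorph0 pi); apply/eq_pi_edge; rewrite subr0.
  exact: rpred0.
apply/negP; rewrite -ltnNge.
have le1 : ((D * N).+1 ^ d <= D.+1 ^ d * N ^ d)%N.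
  rewrite -expnMn; case: (d) => // d'; rewrite leq_exp2r //.
  by rewrite mulSn -addn1 addnC leq_add2r.
apply: leq_ltn_trans (leq_mul (leqnn C) le1) _.
rewrite mulnA; apply: (@leq_trans (N ^ d.+1)); last by rewrite leq_pexp2l.
by rewrite expnS ltn_pmul2r ?expn_gt0 // /N ltnS.
Qed.

End UpperBound.

(** * The a-invariant *)

(** The Krull dimension is the largest size of an independent set. *)
Lemma edge_ideal_krull_dim (K : fieldType) (n : nat) (G : sgraph 'I_n) :
  exists d, (forall S, indep G S -> #|S| <= d)%N /\
    is_krull_dim {ideal_quot (edge_ideal K G)} d.
Proof.
pose S := [arg max_(T > set0 | indep G T) #|T|].
have [iS Smax] : indep G S /\ forall T, indep G T -> (#|T| <= #|S|)%N.
  by rewrite /S; case: arg_maxnP => //; apply: indep0.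
exists #|S|; split=> //; split; first exact: edge_ideal_dim_ge.
by move=> e P; apply: edge_ideal_dim_le.
Qed.

Theorem theorem1p1 (K : fieldType) (n : nat) (G : sgraph 'I_n) :
  cameron_walker G -> is_a_invariant (edge_ideal K G) 0%R.
Proof.
move=> /odd_indep odd_G; have [d [dmax dimd]] := edge_ideal_krull_dim K G.
have sh : size (hpoly G d) = d.+1 by apply: size_hpoly.
exists d, (hpoly G d); split=> //; last by rewrite sh subrr.
split; first by rewrite -size_poly_eq0 sh.
by exists (hilb G); [apply: hilbP | apply: coef_hpoly].
Qed.
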